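(* If $\{\pi_n\}_{n\ge1}$ is a uniformly distributed sequence of partitions of $[0,1]$, with $\pi_n=\{[t_{i-1}^n,t_i^n]:1\le i\le k(n)\}$, then the sequential random reordering of the points $t_i^n$ ($1\le i\le k(n)$, $n\in\mathbb{N}$) defining the partitions is almost surely a uniformly distributed sequence of points in $[0,1]$.
   Context: A partition of $[0,1]$ is a finite family of intervals $\{[t_{i-1},t_i]:1\le i\le k\}$ with $0=t_0<t_1<\dots<t_k=1$. A sequence of partitions $\{\pi_n\}$, $\pi_n=\{[t_{i-1}^n,t_i^n]:1\le i\le k(n)\}$, is uniformly distributed if for every continuous function $f$ on $[0,1]$ $$\lim_{n\to\infty}\frac{1}{k(n)}\sum_{i=1}^{k(n)}f(t_i^n)=\int_0^1 f(t)\,dt.$$ A sequence of points $\{x_n\}$ in $[0,1]$ is uniformly distributed if for every continuous function $f$ on $[0,1]$ $$\lim_{N\to\infty}\frac1N\sum_{i=1}^N f(x_i)=\int_0^1 f(x)\,dx.$$ Sequential random reordering: put $K(0)=0$ and $K(n)=\sum_{i=1}^n k(i)$. For each $n$ let $W_n=\{t_1^n,\dots,t_{k(n)}^n\}$ and let $T_n$ be the set of all permutations of $W_n$ (equivalently, of the indices $\{1,\dots,k(n)\}$), with the uniform probability, so that each $\tau_n\in T_n$ has probability $\frac{1}{k(n)!}$. Let $T=\prod_{n=1}^\infty T_n$ carry the product probability. The sequential random reordering is the sequence of random variables $\{\varphi_m\}_{m\ge1}$ on $T$ made of consecutive blocks of lengths $k(1),k(2),\dots$, where the $n$-th block $(\varphi_m)_{K(n-1)<m\le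 K(n)}$ lists the points of $W_n$ in the order given by $\tau_n$, i.e. $\varphi_{K(n-1)+i}=t^n_{\tau_n(i)}$ for $1\le i\le k(n)$. (Thus the $n$-th block represents the successive draws, without replacement, of all the points of $W_n$, and different blocks are independent.) ''Almost surely'' refers to the product probability on $T$. *)

(* Defs.v *)
From HB Require Import structures.
From mathcomp Require Import all_boot all_order all_algebra all_fingroup.
From mathcomp Require Import all_classical all_reals all_analysis.
From mathcomp Require Import measurable_realfun ring.
Import Order.TTheory GRing.Theory Num.Theory.
Import numFieldNormedType.Exports.

Set Implicit Arguments.
Unset Strict Implicit.
Unset Printing Implicit Defensive.

Local Open Scope classical_set_scope.
Local Open Scope ring_scope.

(* A partition 0 = t_0 < t_1 < ... < t_k = 1 is given by the sequence
   s = [:: t_1; ...; t_k] with [itv_partition 0 1 s], so k = size s >= 1 and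
   t_(i+1) = s`_i.  Families indexed by n >= 1 in the source (partitions,
   points, permutations) are indexed here by n : nat starting from 0. *)

Definition ud_partitions (R : realType) (pi : nat -> seq R) : Prop :=
  (forall n, itv_partition 0 1 (pi n)) /\
  forall f : R -> R, {within `[0, 1], continuous f} ->
    (fun n => (size (pi n))%:R^-1 * \sum_(i < size (pi n)) f (pi n)`_i) @ \oo
      --> \int[lebesgue_measure]_(x in `[0, 1]) f x.

Definition ud_points (R : realType) (x : nat -> R) : Prop :=
  (forall n, x n \in `[0, 1]) /\
  forall f : R -> R, {within `[0, 1], continuous f} ->
    (fun N => N%:R^-1 * \sum_(i < N) f (x i)) @ \oo
      --> \int[lebesgue_measure]_(x in `[0, 1]) f x.

Section reorderings.
Context {R : realType} (pi : nat -> seq R).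

(* T_n, acting on the indices of the points of pi n. *)
Definition perms n := {perm 'I_(size (pi n))}.

Definition all_perms := forall n, perms n.

HB.instance Definition _ := gen_eqMixin all_perms.
HB.instance Definition _ := gen_choiceMixin all_perms.
HB.instance Definition _ := isPointed.Build all_perms (fun=> 1%g).

Definition coordinate_events : set (set all_perms) :=
  [set E | exists n (A : {set perms n}), E = [set w | w n \in A]].

(* T = \prod_n T_n with its product sigma-algebra. *)
Definition reorderings := g_sigma_algebraType coordinate_events.

(* P is the product of the uniform probabilities on the T_n. *)
Definition product_uniform (P : probability reorderings R) : Prop :=
  forall n (A : forall i, {set perms i}),
    P [set w | forall i, (i < n)%N -> w i \in A i] =
    (\prod_(i < n) (#|A i|%:R / (size (pi i))`!%:R))%:E.

Definition block (w : reorderings) n : seq R :=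
  [seq (pi n)`_(w n i) | i <- enum 'I_(size (pi n))].

(* The infinite concatenation of the blocks: since no block is empty when the
   pi n are partitions, the first m.+1 blocks contain the point of index m. *)
Definition sequential_reordering (w : reorderings) (m : nat) : R :=
  (flatten [seq block w n | n <- iota 0 m.+1])`_m.

End reorderings.

Arguments coordinate_events {R} pi.

Section sequential_reordering_theory.
Context {R : realType} (pi : nat -> seq R).

Lemma sequential_reorderingE (w : reorderings pi) n (i : 'I_(size (pi n))) :
  (forall n, itv_partition 0 1 (pi n)) ->
  sequential_reordering w (\sum_(j < n) size (pi j) + i) = (pi n)`_(w n i).
Proof.
move=> pi_part; rewrite /sequential_reordering.
have sz_block j : size (block w j) = size (pi j).
  by rewrite size_map size_enum_ord.
have sz_gt0 j : (0 < size (pi j))%N.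
  have := pi_part j; case: (pi j) => // /itv_partition_nil/eqP.
  by rewrite eq_sym oner_eq0.
have sz_flat a b : size (flatten [seq block w j | j <- iota a b]) =
    (\sum_(j <- iota a b) size (pi j))%N.
  rewrite size_flatten /shape -map_comp sumnE big_map.
  by apply: eq_bigr => j _ /=.
set K := (\sum_(j < n) size (pi j))%N.
have le_nK : (n <= K)%N.
  rewrite -[X in (X <= _)%N]card_ord -sum1_card.
  by apply: leq_sum => j _; exact: sz_gt0.
have -> : (K + i).+1 = (n + (1 + (K + i - n)))%N.
  by rewrite add1n addnS subnKC// (leq_trans le_nK)// leq_addr.
rewrite iotaD map_cat flatten_cat nth_cat sz_flat add0n.
have -> : \sum_(j <- iota 0 n) size (pi j) = K.
  by rewrite /K -(big_mkord xpredT (fun j => size (pi j))) /index_iota subn0.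
rewrite ltnNge leq_addr/= addKn nth_cat sz_block ltn_ord.
by rewrite (nth_map i) ?size_enum_ord// nth_ord_enum.
Qed.

(* The product of the uniform probabilities exists: it is the law of the
   mixed-radix digits of a uniform random number in [0, 1). *)

Let m n := (size (pi n))`!.
Let M n := (\prod_(i < n) m i)%N.

Let m_gt0 n : (0 < m n)%N. Proof. exact: fact_gt0. Qed.

Let M_gt0 n : (0 < M n)%N. Proof. by rewrite prodn_gt0. Qed.

Let MS n : M n.+1 = (M n * m n)%N.
Proof. by rewrite /M big_ord_recr. Qed.

Let card_perms n : #|{: perms pi n}| = m n.
Proof. by rewrite card_Sn. Qed.

Let c n (x : R) : nat := Num.truncn (x * (M n)%:R).

Let cS n x : 0 <= x -> (c n.+1 x %/ m n)%N = c n x.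
Proof.
move=> x0; apply/esym/truncn_def.
have /truncn_itv/andP[h1 h2] : 0 <= x * (M n.+1)%:R by rewrite mulr_ge0.
rewrite -/(c n.+1 x) in h1 h2.
have m0 : 0 < (m n)%:R :> R by rewrite ltr0n.
apply/andP; split.
  rewrite -(ler_pM2r m0) -mulrA -!natrM -MS (le_trans _ h1)// ler_nat.
  exact: leq_trunc_div.
rewrite -(ltr_pM2r m0) -mulrA -!natrM -MS (lt_le_trans h2)// ler_nat.
by rewrite ltn_ceil.
Qed.

Let digits (x : R) : reorderings pi :=
  fun n => nth 1%g (enum {: perms pi n}) (c n.+1 x %% m n).

(* The numerator of the left end of the interval with first digits w. *)
Fixpoint numer (w : reorderings pi) n : nat :=
  if n is n'.+1 then numer w n' * m n' + index (w n') (enum {: perms pi n'})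
  else 0.

Let index_lt n (s : perms pi n) : (index s (enum {: perms pi n}) < m n)%N.
Proof. by rewrite -card_perms cardE index_mem mem_enum. Qed.

Let numer_lt w n : (numer w n < M n)%N.
Proof.
elim: n => [|n ih] /=; first by rewrite M_gt0.
rewrite MS (leq_trans (_ : _ < (numer w n).+1 * m n)%N)//.
  by rewrite mulSnr ltn_add2l index_lt.
by rewrite leq_mul2r ih orbT.
Qed.

Let digits_eq x n (s : perms pi n) :
  (digits x n = s) <-> (c n.+1 x %% m n = index s (enum {: perms pi n}))%N.
Proof.
have lt : (c n.+1 x %% m n < size (enum {: perms pi n}))%N.
  by rewrite -cardE card_perms ltn_mod m_gt0.
split=> [<-|h]; first by rewrite /digits index_uniq// enum_uniq.
by rewrite /digits h nth_index// mem_enum.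
Qed.

Let digits_prefix w n x : 0 <= x < 1 ->
  (forall i, (i < n)%N -> digits x i = w i) <-> c n x = numer w n.
Proof.
move=> /andP[x0 x1]; elim: n => [|n ih].
  split=> // _; rewrite /c /M big_ord0 mulr1; apply: truncn_def.
  by rewrite x0.
rewrite [numer _ _]/=; split=> [h|h].
  rewrite (divn_eq (c n.+1 x) (m n)) cS//; congr (_ * _ + _)%N.
    by apply/ih => i i_n; apply: h; rewrite ltnS ltnW.
  by apply/digits_eq/h.
have lti := index_lt (w n).
have hn : c n x = numer w n.
  by rewrite -cS// h divnMDl// divn_small// addn0.
move=> i; rewrite ltnS leq_eqVlt => /predU1P[->|]; last by move/ih: hn; exact.
by apply/digits_eq; rewrite h modnMDl modn_small.
Qed.

Let measurable_c n j : measurable [set x | c n x = j].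
Proof.
have mc : measurable_fun setT (fun x : R => x * (M n)%:R).
  exact: mulrr_measurable.
have -> : [set x | c n x = j] =
    (fun x : R => x * (M n)%:R) @^-1` [set y | Num.truncn y = j] by [].
rewrite -[X in measurable X]setTI; apply: mc => //.
have [->|j0] := eqVneq j 0%N.
  suff -> : [set y : R | Num.truncn y = 0%N] = [set` `]-oo, 1[] by [].
  apply/seteqP; split => y /=; rewrite in_itv/=.
    by move=> h; have := truncnS_gt y; rewrite h.
  move=> y1; have [y0|y0] := leP 0 y; first by apply: truncn_def; rewrite y0.
  by apply/truncn0Pn; rewrite -ltNge.
suff -> : [set y : R | Num.truncn y = j] = [set` `[j%:R, j.+1%:R[] by [].
apply/seteqP; split => y /=; rewrite in_itv/=.
  have [y0 <-|y0] := leP 0 y; first exact: truncn_itv.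
  move=> h; case/eqP: j0; rewrite -h; apply/truncn0Pn.
  by rewrite -ltNge (lt_trans y0).
exact: truncn_def.
Qed.

Let measurable_digits : measurable_fun (setT : set R) digits.
Proof.
have mE : @measurable _ (reorderings pi) = <<s coordinate_events pi >> by [].
refine (@measurability _ _ _ _ setT digits _ mE _).
move=> _ [_ [n [A ->]] <-]; rewrite setTI.
rewrite (_ : _ @^-1` _ = \bigcup_(j in [set j |
    nth 1%g (enum {: perms pi n}) (j %% m n) \in A]) [set x | c n.+1 x = j]).
  by apply: bigcup_measurable => j _; exact: measurable_c.
apply/seteqP; split => x /=; first by move=> xA; exists (c n.+1 x).
by move=> [j /= jA xj]; rewrite /digits xj.
Qed.

Definition digits_law (A : set (reorderings pi)) : \bar R :=
  lebesgue_measure (digits @^-1` A `&` [set` `[(0 : R), 1[]).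

Let measurable_digits_event (A : set (reorderings pi)) : measurable A ->
  measurable (digits @^-1` A `&` [set` `[(0 : R), 1[]).
Proof.
move=> mA; apply: measurableI; last exact: measurable_itv.
by rewrite -[X in measurable X]setTI; exact: measurable_digits.
Qed.

Let digits_law0 : digits_law set0 = 0%E.
Proof. by rewrite /digits_law preimage_set0 set0I measure0. Qed.

Let digits_law_ge0 A : (0 <= digits_law A)%E.
Proof. exact: measure_ge0. Qed.

Let digits_law_sigma_additive : semi_sigma_additive digits_law.
Proof.
move=> F mF tF mUF; rewrite /digits_law preimage_bigcup setI_bigcupl.
apply: measure_semi_sigma_additive.
- by move=> n; exact: measurable_digits_event.
- apply/trivIsetP => i j _ _ ij; rewrite setIACA -preimage_setI.
  by move/trivIsetP : tF => /(_ _ _ I I ij) ->; rewrite preimage_set0 set0I.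
- rewrite -setI_bigcupl -preimage_bigcup; exact: measurable_digits_event.
Qed.

HB.instance Definition _ := isMeasure.Build _ _ _ digits_law
  digits_law0 digits_law_ge0 digits_law_sigma_additive.

Let digits_law_setT : digits_law setT = 1%E.
Proof.
rewrite /digits_law preimage_setT setTI lebesgue_measure_itv/= lte_fin ltr01.
by rewrite sube0.
Qed.

HB.instance Definition _ := Measure_isProbability.Build _ _ _ digits_law
  digits_law_setT.

Let P : probability (reorderings pi) R := digits_law.

Let P_prefix (w : reorderings pi) n :
  P [set v | forall i, (i < n)%N -> v i = w i] = ((M n)%:R^-1)%:E.
Proof.
rewrite /P/= /digits_law.
have M0 : 0 < (M n)%:R :> R by rewrite ltr0n.
rewrite (_ : _ `&` _ = [set` `[(numer w n)%:R / (M n)%:R,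
    (numer w n).+1%:R / (M n)%:R[ ]).
  rewrite lebesgue_measure_itv/= lte_fin ltr_pM2r ?invr_gt0// ltr_nat ltnSn.
  by rewrite -EFinD -mulrBl -natrB// subSnn mul1r.
apply/seteqP; split => x /=.
  move=> [xw]; rewrite in_itv/= => x01.
  have /andP[x0 _] := x01.
  move/(digits_prefix w n x01) : xw => <-.
  by rewrite in_itv/= ler_pdivrMr// ltr_pdivlMr// truncn_itv// mulr_ge0.
rewrite in_itv/= => /andP[xl xu].
have x01 : 0 <= x < 1.
  rewrite (le_trans _ xl) ?divr_ge0//= (lt_le_trans xu)//.
  by rewrite ler_pdivrMr// mul1r ler_nat numer_lt.
split; last by rewrite in_itv.
apply/(digits_prefix w n x01)/truncn_def.
by rewrite -ler_pdivrMr// -ltr_pdivlMr// xl.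
Qed.

Let measurable_coordinate n (A : {set perms pi n}) :
  measurable ([set v | v n \in A] : set (reorderings pi)).
Proof. by apply: sub_sigma_algebra; exists n, A. Qed.

Let P_rectangle (A : forall i, {set perms pi i}) q p (w : reorderings pi) :
  P [set v | (forall i, (i < p)%N -> v i = w i) /\
             (forall i, (p <= i < p + q)%N -> v i \in A i)] =
  ((M p)%:R^-1 * \prod_(p <= i < p + q) (#|A i|%:R / (m i)%:R))%:E.
Proof.
elim: q p w => [|q ih] p w.
  rewrite addn0 big_geq// mulr1 -(P_prefix w); congr (P _).
  apply/seteqP; split => v /=; first by case.
  by split=> // i /andP[pi']; rewrite ltnNge pi'.
pose F (s : perms pi p) : set (reorderings pi) :=
  [set v | (forall i, (i < p.+1)%N -> v i = dfwith w p s i) /\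
           (forall i, (p.+1 <= i < p.+1 + q)%N -> v i \in A i)].
have FE s : P (F s) =
    ((M p.+1)%:R^-1 * \prod_(p.+1 <= i < p.+1 + q) (#|A i|%:R / (m i)%:R))%:E.
  by rewrite ih.
have mF s : measurable (F s).
  rewrite (_ : F s = \bigcap_i (if (i < p.+1)%N
      then [set v : reorderings pi | v i \in [set dfwith w p s i]%SET]
      else if (i < p.+1 + q)%N then [set v | v i \in A i] else setT)).
    apply: bigcap_measurable => [|i _]; first by exists 0%N.
    by case: ifP => _; [|case: ifP => _]; try exact: measurable_coordinate;
      exact: measurableT.
  apply/seteqP; split => v /=.
    move=> [h1 h2] i _; case: ltnP => ip /=; first by rewrite h1// inE.
    by case: ltnP => //= ipq; apply: h2; rewrite ip.
  move=> h; split=> i => [ip|/andP[pi' ipq]]; have := h i I.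
    by rewrite ip/= inE => /eqP.
  by rewrite ltnNge pi'/= ipq.
rewrite (_ : [set _ | _] = \bigcup_(s in [set s | s \in A p]) F s); last first.
  apply/seteqP; split => v /=.
    move=> [h1 h2]; exists (v p).
      by apply: h2; rewrite leqnn/= addnS ltnS leq_addr.
    split=> i.
      rewrite ltnS leq_eqVlt => /predU1P[->|ip]; first by rewrite dfwithin.
      by rewrite dfwithout ?h1// gtn_eqF.
    by move=> /andP[pi' ipq]; apply: h2; rewrite ltnW//= addnS.
  move=> [s /= sA [h1 h2]]; split=> i.
    by move=> ip; rewrite h1 ?ltnS 1?ltnW// dfwithout// gtn_eqF.
  move=> /andP[]; rewrite leq_eqVlt => /predU1P[<- _|ip ipq].
    by rewrite h1// dfwithin.
  by apply: h2; rewrite ip/= addSnnS.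
rewrite measure_fin_bigcup//; last first.
  move=> s t _ _ [v [[hs _] [ht _]]].
  by have := hs p (ltnSn p); rewrite ht// !dfwithin.
rewrite (eq_fsbigr (fun=> ((M p.+1)%:R^-1 *
  \prod_(p.+1 <= i < p.+1 + q) (#|A i|%:R / (m i)%:R))%:E)) => [|s _]; last first.
  exact: FE.
rewrite (fsbigE (enum (A p))) ?enum_uniq//; last 2 first.
- by move=> s /=; rewrite mem_enum.
- by move=> s /= sA; rewrite mem_enum sA.
rewrite big_enum_cond/= sumEFin (eq_bigl [in A p]) => [|s]; last first.
  by rewrite andb_idr// => sA; rewrite inE.
congr EFin.
rewrite sumr_const -[LHS]mulr_natr addnS -addSn [in RHS]big_ltn; last first.
  by rewrite addSn ltnS leq_addr.
rewrite MS natrM (invfM (M p)%:R); ring.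
Qed.

Lemma product_uniform_exists :
  exists Q : probability (reorderings pi) R, product_uniform Q.
Proof.
exists P => n A.
have := P_rectangle A n 0 (fun=> 1%g).
rewrite {1}/M big_ord0 invr1 mul1r add0n big_mkord => <-; congr (P _).
by apply/seteqP; split=> v /= h; [split=> // i /h|case: h].
Qed.

End sequential_reordering_theory.

(* Main.v *)
Require Import Defs.
From mathcomp Require Import all_boot all_order all_algebra all_fingroup.
From mathcomp Require Import all_classical all_reals all_analysis.
From mathcomp Require Import ring lra zify.
Import Order.TTheory GRing.Theory Num.Theory.
Import numFieldNormedType.Exports.

(** Replace each value [f x_m] along the sequential reordering by its deviation
    from the mean of [f] over the block that contains [x_m].  The block means
    are deterministic and tend to the integral of [f], because the partitions
    are uniformly distributed; repeating each mean over its block and averaging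
    gives the same limit by Cesaro ([mean_block_means_cvg]).  It remains to see
    that the accumulated deviation [T_N] is almost surely [o(N)].

    Completed blocks contribute nothing to [T_N], whatever their order, so [T_N]
    is the centred sum of the draws made so far in the current block, and only
    one random permutation matters at a time ([deviation_block]).  Draws without
    replacement are negatively correlated ([sum_perm_pair_le0]), so the second
    moment of [T_N] is at most the number of those draws, hence at most [N], if
    [f] takes its values in [0, 1].  By Chebyshev, [|T_N| >= e N] has
    probability at most [1 / (e^2 N)] ([large_deviation_prob]).  This is
    summable along the squares, so that Borel-Cantelli controls [T_N] there
    ([ae_deviation_squares]); between consecutive squares [T_N] moves by
    [O(sqrt N)] only ([sublinear_squares]).

    The exceptional null set may depend on [f], whereas uniform distribution
    quantifies over uncountably many [f].  So the deviations are controlled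
    simultaneously for the countably many indicators of the cells of regular
    grids of mesh [1 / (r+1)].  Step functions on these grids approximate every
    continuous function uniformly on [0, 1], and being [o(N)] passes to linear
    combinations and uniform limits
    ([sublinear_deviation_continuous]). *)

Set Implicit Arguments.
Unset Strict Implicit.
Unset Printing Implicit Defensive.

Local Open Scope classical_set_scope.
Local Open Scope ring_scope.

(** * Second moment of sampling without replacement *)

(** Negative correlation of two distinct draws: by exchangeability the sum does
    not depend on [q], and summed over all [q != p] it is minus a sum of
    squares, because the other draws add up to the opposite of [a (s p)]. *)
Lemma sum_perm_pair_le0 (R : realDomainType) k (a : 'I_k -> R) (p q : 'I_k) :
  \sum_i a i = 0 -> p != q -> \sum_(s : 'S_k) a (s p) * a (s q) <= 0.
Proof.
move=> a0 pq; set c := \sum_s _.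
have cE q' : q' != p -> \sum_(s : 'S_k) a (s p) * a (s q') = c.
  move=> q'p; rewrite (reindex_inj (mulgI (tperm q q'))) /=.
  by apply: eq_bigr => s _; rewrite !permM tpermR tpermD// eq_sym.
have : \sum_(q' | q' != p) \sum_(s : 'S_k) a (s p) * a (s q') <= 0.
  rewrite exchange_big /=; apply: sumr_le0 => s _.
  have /eqP : \sum_i a (s i) = 0 by rewrite -[RHS]a0 [RHS](reindex_inj (@perm_inj _ s)).
  rewrite (bigD1 p)//= addrC addr_eq0 => /eqP h.
  by rewrite -mulr_sumr h mulrN -expr2 oppr_le0 sqr_ge0.
rewrite (eq_bigr (fun=> c)) // sumr_const pmulrn_lle0 //.
by apply/card_gt0P; exists q; rewrite unfold_in eq_sym.
Qed.

(** Expanding the square leaves at most [#|J|] diagonal terms to bound, since the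
    others are nonpositive. *)
Lemma sum_perm_sqr_le (R : realDomainType) k (a : 'I_k -> R) (J : pred 'I_k) :
  \sum_i a i = 0 -> (forall i, `|a i| <= 1) ->
  \sum_(s : 'S_k) (\sum_(i | J i) a (s i)) ^+ 2 <= (#|J| * k`!)%:R.
Proof.
move=> a0 a1.
under eq_bigr => s _ do rewrite expr2 big_distrlr /=.
rewrite exchange_big /= -sum1_card big_distrl natr_sum /=.
apply: ler_sum => i Ji; rewrite mul1n exchange_big /= (bigD1 i) //=.
rewrite -[leRHS]addr0 lerD //; last first.
  by apply: sumr_le0 => i' /andP[_ ne]; rewrite sum_perm_pair_le0 // eq_sym.
rewrite -card_Sn -sum1_card natr_sum; apply: ler_sum => s _.
by rewrite -expr2 -real_normK ?num_real// exprn_ile1.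
Qed.

Lemma chebyshev_card (R : realDomainType) (T : finType) (D : T -> R) (c : R) :
  0 <= c -> #|[set t | c <= `|D t|]%SET|%:R * c ^+ 2 <= \sum_t D t ^+ 2.
Proof.
move=> c0; rewrite mulr_natl -sumr_const big_mkcond /=; apply: ler_sum => t _.
rewrite inE; case: ifP => [cD|_]; last exact: sqr_ge0.
by rewrite -(real_normK (num_real (D t))) ler_sqr// nnegrE.
Qed.

(** * Consecutive blocks of given lengths *)

Definition offset (k : nat -> nat) n := (\sum_(j < n) k j)%N.

(** Counting the blocks that end at or before position [m] gives the number of
    the block that contains [m]. *)
Definition block_index (k : nat -> nat) m :=
  (\sum_(0 <= n < m) (offset k n.+1 <= m))%N.

Section blocks.
Variables (k : nat -> nat) (k_gt0 : forall n, (0 < k n)%N).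

Lemma offsetS n : offset k n.+1 = (offset k n + k n)%N.
Proof. by rewrite /offset big_ord_recr. Qed.

Lemma leq_offset n p : (n <= p)%N -> (offset k n <= offset k p)%N.
Proof.
move=> /subnK <-; elim: (p - n)%N => // d ih; rewrite addSn offsetS.
exact: leq_trans ih (leq_addr _ _).
Qed.

Lemma offset_ge n : (n <= offset k n)%N.
Proof. by elim: n => // n ih; rewrite offsetS -addn1 leq_add. Qed.

Lemma offset_decomposition m :
  exists n i, (i < k n)%N /\ m = (offset k n + i)%N.
Proof.
elim: m => [|m [n [i [ik ->]]]].
  by exists 0%N, 0%N; rewrite /offset big_ord0; split.
have [ik'|ik'] := ltnP i.+1 (k n); first by exists n, i.+1; rewrite addnS.
exists n.+1, 0%N; split=> //; rewrite addn0 offsetS -addnS; congr addn.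
by apply/eqP; rewrite eqn_leq ik ik'.
Qed.

Lemma block_indexE n i : (i < k n)%N -> block_index k (offset k n + i) = n.
Proof.
move=> ik; rewrite /block_index.
have nm : (n <= offset k n + i)%N by rewrite (leq_trans (offset_ge n))// leq_addr.
rewrite (@big_cat_nat _ _ _ n) //= big_nat (eq_bigr (fun=> 1%N)); last first.
  by move=> j jn; rewrite (leq_trans (leq_offset jn)) ?leq_addr.
rewrite -big_nat sum_nat_const_nat muln1 subn0 big_nat big1 ?addn0// => j /andP[nj _].
rewrite leqNgt (leq_trans _ (leq_offset (_ : (n.+1 <= j.+1)%N)))//.
by rewrite offsetS ltn_add2l.
Qed.

(** Each block is finite, so its positions are eventually left behind. *)
Lemma block_index_cvg : block_index k @ \oo --> \oo.
Proof.
apply/cvgnyPge => A; near=> m.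
have [n [i [ik mE]]] := offset_decomposition m; rewrite mE block_indexE //.
rewrite leqNgt; apply/negP => nA.
have : (offset k A <= m)%N by near: m; exact: nbhs_infty_ge.
by rewrite mE leqNgt (leq_trans _ (leq_offset nA))// offsetS ltn_add2l.
Unshelve. all: end_near. Qed.

Lemma sum_blocks (V : nmodType) (F : nat -> V) n j :
  \sum_(m < offset k n + j) F m =
  \sum_(i < n) \sum_(l < k i) F (offset k i + l)%N +
  \sum_(l < j) F (offset k n + l)%N.
Proof.
rewrite big_split_ord /=; congr +%R; elim: n => [|n ih].
  by rewrite /offset !big_ord0.
by rewrite offsetS big_split_ord /= ih big_ord_recr.
Qed.

End blocks.

(** * Sequences that are o(N) *)

Section sublinear.
Context {R : realType}.
Implicit Types u v : nat -> R.

Definition sublinear u := (fun N => N%:R^-1 * u N) @ \oo --> (0 : R).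

Lemma sublinearP u : sublinear u <->
  forall e, 0 < e -> \forall N \near \oo, `|u N| <= e * N%:R.
Proof.
have eqv e N : (0 < N)%N ->
    (`|0 - N%:R^-1 * u N| <= e) = (`|u N| <= e * N%:R).
  move=> N0; rewrite sub0r normrN normrM normfV normr_nat mulrC.
  by rewrite ler_pdivrMr ?ltr0n.
split=> [/cvgrPdist_le h e e0|h].
  near=> N; rewrite -eqv; first by near: N; exact: h.
  by near: N; exact: nbhs_infty_gt.
apply/cvgrPdist_le => e e0; near=> N; rewrite eqv; first by near: N; exact: h.
by near: N; exact: nbhs_infty_gt.
Unshelve. all: end_near. Qed.

Lemma sublinear_comb r (c : 'I_r -> R) (u : 'I_r -> nat -> R) :
  (forall i, sublinear (u i)) -> sublinear (fun N => \sum_i c i * u i N).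
Proof.
move=> su; rewrite /sublinear.
have -> : (fun N => N%:R^-1 * \sum_i c i * u i N) =
    (fun N => \sum_i c i * (N%:R^-1 * u i N)).
  by apply/funext => N; rewrite mulr_sumr; apply: eq_bigr => i _; rewrite mulrCA.
rewrite -[X in _ --> X](_ : \sum_(i < r) c i * 0 = 0); last first.
  by apply: big1 => i _; rewrite mulr0.
apply: cvg_big => [|i _]; last by apply: cvgMr; exact: su.
exact: add_continuous.
Qed.

Lemma sublinear_approx u :
  (forall e, 0 < e -> exists2 v, sublinear v &
     forall N, `|u N - v N| <= e * N%:R) -> sublinear u.
Proof.
move=> h; apply/sublinearP => e e0; have e20 : 0 < e / 2 by rewrite divr_gt0.
have [v /sublinearP/(_ _ e20) sv uv] := h _ e20.
near=> N.
rewrite -[u N](subrK (v N)) (le_trans (ler_normD _ _))// (splitr e) mulrDl.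
rewrite lerD//; near: N; exact: sv.
Unshelve. all: end_near. Qed.

Lemma lipschitz_seq u : (forall n, `|u n.+1 - u n| <= 1) ->
  forall n d, `|u (n + d)%N - u n| <= d%:R.
Proof.
move=> u1 n; elim=> [|d ih]; first by rewrite addn0 subrr normr0.
rewrite addnS (le_trans (ler_distD (u (n + d)%N) _ _))//.
by rewrite -natr1 addrC lerD// ih.
Qed.

Lemma exists_sqrtn N : (0 < N)%N -> exists m, (m.+1 ^ 2 <= N < m.+2 ^ 2)%N.
Proof.
elim: N => // -[|N] ih _; first by exists 0%N.
have [m /andP[h1 h2]] := ih isT.
have [h3|h3] := ltnP N.+2 (m.+2 ^ 2); first by exists m; rewrite h3 (leq_trans h1).
by exists m.+1; rewrite h3/= (leq_ltn_trans h2)// ltn_sqr.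
Qed.

(** Consecutive squares [M = (m+1)^2] and [(m+2)^2] are [2 m + 3] apart, which is
    negligible compared to [M]; a sequence with bounded increments cannot
    deviate much between them. *)
Lemma sublinear_squares u : (forall n, `|u n.+1 - u n| <= 1) ->
  (forall e, 0 < e ->
     \forall m \near \oo, `|u (m.+1 ^ 2)%N| <= e * (m.+1 ^ 2)%:R) ->
  sublinear u.
Proof.
move=> u1 usq; apply/sublinearP => e e0; have e20 : 0 < e / 2 by rewrite divr_gt0.
(* The second conjunct makes the increments between squares at most [e/2 N]. *)
have [A _ hA] : \forall m \near \oo,
    `|u (m.+1 ^ 2)%N| <= e / 2 * (m.+1 ^ 2)%:R /\ 2 <= e / 2 * m.+1%:R.
  near=> m; split; first by near: m; exact: usq.
  rewrite mulrC -ler_pdivrMr// (@le_trans _ _ m%:R) ?ler_nat//; near: m.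
  exact: nbhs_infty_ger.
near=> N.
have /exists_sqrtn[m /andP[mN Nm]] : (0 < N)%N by near: N; exact: nbhs_infty_gt.
have Am : (A <= m)%N.
  rewrite -ltnS -ltnS -ltn_sqr (leq_ltn_trans _ Nm)//.
  by near: N; exact: nbhs_infty_ge.
have [h1 h2] := hA m Am.
rewrite -(subrK (u (m.+1 ^ 2)%N) (u N)) (le_trans (ler_normD _ _))//.
have h3 : (N - m.+1 ^ 2)%:R <= 2 * m.+1%:R :> R.
  rewrite -natrM ler_nat leq_subLR -ltnS (leq_trans Nm)//.
  by rewrite -addn1 sqrnD; lia.
have h4 : `|u N - u (m.+1 ^ 2)%N| <= (N - m.+1 ^ 2)%:R.
  by rewrite -{1}(subnKC mN) lipschitz_seq.
have h5 : (m.+1 ^ 2)%:R <= N%:R :> R by rewrite ler_nat.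
have h6 : 2 * m.+1%:R <= e / 2 * (m.+1 ^ 2)%:R by rewrite natrX expr2 mulrA ler_pM2r.
have h7 : e / 2 * (m.+1 ^ 2)%:R <= e / 2 * N%:R by rewrite ler_pM2l.
lra.
Unshelve. all: end_near. Qed.

End sublinear.

(** * Uniform continuity and step functions *)

(** Heine-Cantor, by the covering form of compactness: the admissible mesh works
    locally with half the tolerance, and locally uniform means uniform. *)
Lemma unif_continuous_segment (R : realType) (a b : R) (f : R -> R) :
  {within `[a, b], continuous f} -> forall e, 0 < e ->
  \forall n \near \oo, forall x y, x \in `[a, b] -> y \in `[a, b] ->
    `|x - y| <= n.+1%:R^-1 -> `|f x - f y| <= e.
Proof.
move=> /subspace_continuousP cf e e0; have e20 : 0 < e / 2 by rewrite divr_gt0.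
have /compact_near_coveringP/near_covering_withinP := @segment_compact R a b.
move=> /(_ nat \oo (fun n x => forall y, y \in `[a, b] ->
  `|x - y| <= n.+1%:R^-1 -> `|f x - f y| <= e)) [|N _ hN]; last first.
  by exists N => // n Nn x y xab; exact: (hN n Nn x xab).
move=> x xab.
have /cvgrPdist_le/(_ _ e20) := cf x xab.
rewrite /within/= => /nbhs_normP[d /= d0 hd].
have d20 : 0 < d / 2 by rewrite divr_gt0.
exists (ball x (d / 2), [set n | n.+1%:R^-1 < d / 2]).
  split; first by apply: nbhsx_ballx; rewrite divr_gt0.
  have := @cvg_harmonic R; move/cvgrPdist_lt/(_ _ d20).
  apply: filterS => n /=; rewrite sub0r normrN ger0_norm//.
move=> [x' n] /= [xx' nd] x'ab y yab x'y.
rewrite /ball /= in xx'.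
have h1 : `|f x - f x'| <= e / 2.
  by apply: hd => //=; rewrite (lt_trans xx')// ltr_pdivrMr// ltr_pMr// ltr1n.
have h2 : `|f x - f y| <= e / 2.
  apply: hd => //=; rewrite -(subrK x' x) -addrA (le_lt_trans (ler_normD _ _))//.
  by rewrite (splitr d) ltrD// (le_lt_trans x'y).
rewrite -(subrK (f x) (f x')) -addrA (le_trans (ler_normD _ _))// (splitr e).
by rewrite lerD// distrC.
Qed.

Section step_functions.
Context {R : realType}.

Definition cell r i (x : R) : R := (Num.truncn (x * r.+1%:R) == i)%:R.

Lemma cell_in01 r i x : cell r i x \in `[0, 1].
Proof. by rewrite in_itv/= /cell; case: eqP; rewrite ?ler01 ?lexx. Qed.

(** The grid points are [i / (r+1)] with [0 <= i <= r+1]: the last cell is needed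
    for [x = 1] only. *)
Lemma step_approx (f : R -> R) e : {within `[0, 1], continuous f} -> 0 < e ->
  exists r, forall x, x \in `[0, 1] ->
   `|f x - \sum_(i < r.+2) f (i%:R / r.+1%:R) * cell r i x| <= e.
Proof.
move=> cf e0; have [r _ hr] := unif_continuous_segment cf e0.
exists r => x x01; have := x01; rewrite in_itv/= => /andP[x0 x1].
have r0 : 0 < r.+1%:R :> R by [].
have /truncn_itv/andP[] : 0 <= x * r.+1%:R by rewrite mulr_ge0.
set t := Num.truncn _ => tl tu.
have tr : (t <= r.+1)%N.
  by rewrite -(ler_nat R) (le_trans tl)// -[leRHS]mul1r ler_pM2r.
rewrite (bigD1 (inord t))//= big1 ?addr0 => [|i it]; last first.
  rewrite /cell -/t; case: eqP => [ti|]; last by rewrite mulr0.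
  by case/eqP: it; rewrite ti inord_val.
rewrite inordK// /cell eqxx mulr1; apply: hr (leqnn r) _ _ x01 _ _.
  by rewrite in_itv/= divr_ge0//= ler_pdivrMr// mul1r ler_nat.
have tx : t%:R / r.+1%:R <= x by rewrite ler_pdivrMr.
rewrite ger0_norm ?subr_ge0// lerBlDr -[X in X + _]mul1r -mulrDl ler_pdivlMr//.
by rewrite addrC natr1 ltW.
Qed.

End step_functions.

(** * Deviation from the block means *)

Lemma mem_itv_partition (R : realType) (a b : R) (s : seq R) x :
  itv_partition a b s -> x \in s -> x \in `[a, b].
Proof.
move=> ps /(nthP b)[i i_s <-]; rewrite in_itv/=.
by rewrite (itv_partition_nth_ge (m := i.+1) i_s ps) (itv_partition_nth_le (m := i.+1) i_s ps).
Qed.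

Section deviation.
Context {R : realType} (pi : nat -> seq R).
Hypothesis pi_part : forall n, itv_partition 0 1 (pi n).

Local Notation sizes := (fun n => size (pi n)).

Lemma size_partition_gt0 n : (0 < size (pi n))%N.
Proof.
have := pi_part n; case: (pi n) => // /itv_partition_nil/eqP.
by rewrite eq_sym oner_eq0.
Qed.

Definition block_mean (g : R -> R) n : R :=
  (size (pi n))%:R^-1 * \sum_(i < size (pi n)) g (pi n)`_i.

Definition deviation (g : R -> R) (w : reorderings pi) N : R :=
  \sum_(m < N) (g (sequential_reordering w m)
                - block_mean g (block_index sizes m)).

Lemma sequential_reordering_in01 (w : reorderings pi) m :
  sequential_reordering w m \in `[0, 1].
Proof.
have [n [i [ik ->]]] := offset_decomposition size_partition_gt0 m.
rewrite (sequential_reorderingE w (Ordinal ik) pi_part).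
by rewrite (mem_itv_partition (pi_part n))// mem_nth.
Qed.

Lemma sum_block_deviation (g : R -> R) n :
  \sum_(i < size (pi n)) (g (pi n)`_i - block_mean g n) = 0.
Proof.
rewrite sumrB sumr_const card_ord /block_mean -[X in _ - X]mulr_natl mulrA.
by rewrite divff ?mul1r ?subrr// pnatr_eq0 -lt0n size_partition_gt0.
Qed.

(** A completed block contributes the sum of all its centred values, which is
    zero in any order. *)
Lemma deviation_block (g : R -> R) (w : reorderings pi) n j :
  (j <= size (pi n))%N ->
  deviation g w (offset sizes n + j) =
  \sum_(l < size (pi n) | (l < j)%N) (g (pi n)`_(w n l) - block_mean g n).
Proof.
move=> jk; have blockE i (l : 'I_(size (pi i))) :
    let m := (offset sizes i + l)%N in
    g (sequential_reordering w m)
      - block_mean g (block_index sizes m) =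
    g (pi i)`_(w i l) - block_mean g i.
  rewrite /= (sequential_reorderingE w l pi_part) block_indexE//.
  exact: size_partition_gt0.
pose F m := g (sequential_reordering w m) - block_mean g (block_index sizes m).
rewrite /deviation -/(F _) (sum_blocks _ F) big1 ?add0r => [|i _].
  rewrite (big_ord_widen _ (fun l => F (offset sizes n + l)%N) jk).
  by apply: eq_bigr => l _; exact: blockE.
rewrite (eq_bigr _ (fun l _ => blockE i l)) -[RHS](sum_block_deviation g i).
by rewrite [RHS](reindex_inj (@perm_inj _ (w i))).
Qed.

Lemma coordinate_prob (P : probability (reorderings pi) R) :
  product_uniform P -> forall n (A : {set perms pi n}),
  P [set w | w n \in A] = (#|A|%:R / (size (pi n))`!%:R)%:E.
Proof.
move=> P_prod n A.
(* The rectangle whose sides are full, except the one of index [n]. *)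
pose B := @dfwith _ (fun i => {set perms pi i}) (fun i => [set: perms pi i]%SET) n A.
have -> : [set w : reorderings pi | w n \in A] =
    [set w | forall i, (i < n.+1)%N -> w i \in B i].
  apply/seteqP; split=> w /=.
    move=> wA i _; rewrite /B; have [->|ni] := eqVneq i n; first by rewrite dfwithin.
    by rewrite dfwithout 1?eq_sym// inE.
  by move=> /(_ n (ltnSn n)); rewrite /B dfwithin.
rewrite P_prod big_ord_recr /= big1 ?mul1r => [|i _].
  by rewrite /B dfwithin.
by rewrite /B dfwithout ?gtn_eqF// cardsT card_Sn divff.
Qed.

Lemma block_mean_in01 (g : R -> R) n :
  (forall x, g x \in `[0, 1]) -> block_mean g n \in `[0, 1].
Proof.
move=> g01; have k0 : 0 < (size (pi n))%:R :> R by rewrite ltr0n size_partition_gt0.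
rewrite in_itv/= /block_mean mulr_ge0 ?sumr_ge0//=; last first.
  by move=> i _; have := g01 (pi n)`_i; rewrite in_itv => /andP[].
rewrite mulrC ler_pdivrMr// mul1r -[in leRHS](card_ord (size (pi n))).
rewrite -sumr_const ler_sum// => i _.
by have := g01 (pi n)`_i; rewrite in_itv => /andP[].
Qed.

Lemma norm_centered_le1 (g : R -> R) n x :
  (forall x, g x \in `[0, 1]) -> `|g x - block_mean g n| <= 1.
Proof.
move=> g01; have := g01 x; have := block_mean_in01 n g01; rewrite !in_itv/=.
by rewrite ler_norml; lra.
Qed.

Lemma deviation_comb (w : reorderings pi) r (c : 'I_r -> R) (g : 'I_r -> R -> R) N :
  deviation (fun x => \sum_i c i * g i x) w N = \sum_i c i * deviation (g i) w N.
Proof.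
rewrite /deviation; under [RHS]eq_bigr => i _ do rewrite mulr_sumr.
rewrite exchange_big /=; apply: eq_bigr => m _.
rewrite /block_mean exchange_big mulr_sumr -sumrB; apply: eq_bigr => i _.
by rewrite mulrBr -mulr_sumr mulrCA.
Qed.

(** One [e] comes from the values and one from the block means. *)
Lemma deviation_dist (f h : R -> R) e (w : reorderings pi) N :
  (forall x, x \in `[0, 1] -> `|f x - h x| <= e) ->
  `|deviation f w N - deviation h w N| <= 2 * e * N%:R.
Proof.
move=> fh; have mean n : `|block_mean f n - block_mean h n| <= e.
  rewrite /block_mean -mulrBr -sumrB normrM normfV normr_nat ler_pdivrMl; last first.
    by rewrite ltr0n size_partition_gt0.
  rewrite mulr_natl -[in leRHS](card_ord (size (pi n))) -sumr_const.
  apply: (le_trans (ler_norm_sum _ _ _)); apply: ler_sum => i _; apply: fh.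
  by rewrite (mem_itv_partition (pi_part n))// mem_nth.
rewrite /deviation -sumrB mulr_natr -[in leRHS](card_ord N) -sumr_const.
apply: (le_trans (ler_norm_sum _ _ _)); apply: ler_sum => m _.
set b := block_index _ _; set x := sequential_reordering _ _.
have -> : f x - block_mean f b - (h x - block_mean h b) =
  (f x - h x) - (block_mean f b - block_mean h b) by ring.
rewrite (le_trans (ler_normB _ _))// mulr_natl mulr2n lerD// fh//.
exact: sequential_reordering_in01.
Qed.

Definition large_deviation (g : R -> R) (e : R) N : set (reorderings pi) :=
  [set w | e * N%:R <= `|deviation g w N|].

(** Chebyshev: at most [N] points of the current block have been drawn, so that
    the second moment of the deviation is at most [N]. *)
Lemma large_deviation_prob (P : probability (reorderings pi) R) (g : R -> R) e N :
  product_uniform P -> (forall x, g x \in `[0, 1]) -> 0 < e -> (0 < N)%N ->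
  measurable (large_deviation g e N) /\
  (P (large_deviation g e N) <= ((e ^+ 2 * N%:R)^-1)%:E)%E.
Proof.
move=> P_prod g01 e0 N0.
have [n [j [jk NE]]] := offset_decomposition size_partition_gt0 N.
pose D (s : perms pi n) : R :=
  \sum_(l < size (pi n) | (l < j)%N) (g (pi n)`_(s l) - block_mean g n).
pose A := [set s | e * N%:R <= `|D s|]%SET.
have devE w : deviation g w N = D (w n) by rewrite NE deviation_block// ltnW.
have -> : large_deviation g e N = [set w | w n \in A].
  by apply/seteqP; split=> w /=; rewrite /large_deviation/= inE devE.
split; first by apply: sub_sigma_algebra; exists n, A.
rewrite coordinate_prob// lee_fin.
have f0 : 0 < (size (pi n))`!%:R :> R by rewrite ltr0n fact_gt0.
have N0' : 0 < N%:R :> R by rewrite ltr0n.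
rewrite ler_pdivrMr// ler_pdivlMl ?mulr_gt0 ?exprn_gt0//.
rewrite -(ler_pM2r N0').
have -> : e ^+ 2 * N%:R * #|A|%:R * N%:R = #|A|%:R * (e * N%:R) ^+ 2 by ring.
have := @chebyshev_card _ _ D (e * N%:R).
have := @sum_perm_sqr_le R (size (pi n)) (fun i => g (pi n)`_i - block_mean g n)
  (fun l => (l < j)%N) (sum_block_deviation g n) (fun i => norm_centered_le1 n _ g01).
move=> h1 h2; apply: (le_trans (h2 _)); first by rewrite mulr_ge0// ltW.
apply: (le_trans h1); rewrite -natrM ler_nat mulnC leq_mul2l; apply/orP; right.
rewrite NE -sum1_card -(big_ord_widen _ (fun=> 1%N) (ltnW jk)).
by rewrite sum1_card card_ord leq_addl.
Qed.

End deviation.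

(** * Almost sure control of the deviation *)

Lemma sum_inv_sqr_le2 (R : realFieldType) n :
  \sum_(m < n) ((m.+1 ^ 2)%:R^-1 : R) <= 2.
Proof.
(* Telescoping, since [1 / (n+1)^2 <= 2 / ((n+1) (n+2))]. *)
suff h : \sum_(m < n) ((m.+1 ^ 2)%:R^-1 : R) <= 2 - 2 / n.+1%:R.
  by rewrite (le_trans h)// lerBlDr lerDl divr_ge0.
elim: n => [|n ih]; first by rewrite big_ord0 divr1 subrr.
rewrite big_ord_recr /=.
suff h : ((n.+1 ^ 2)%:R^-1 : R) <= 2 / n.+1%:R - 2 / n.+2%:R.
  by rewrite (le_trans (lerD ih h))// addrA subrK.
have n1 : 0 < n.+1%:R :> R by [].
have n2 : 0 < n.+2%:R :> R by [].
have -> : 2 / n.+1%:R - 2 / n.+2%:R = 2 / (n.+1 * n.+2)%:R :> R.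
  rewrite natrM -[n.+2]addn1 natrD in n2 *; field.
  by rewrite !gt_eqF.
rewrite ler_pdivlMr ?ltr0n// mulrC ler_pdivrMr ?ltr0n// -natrM ler_nat; lia.
Qed.

Section almost_sure.
Context {R : realType} (pi : nat -> seq R).
Hypothesis pi_part : forall n, itv_partition 0 1 (pi n).
Variables (P : probability (reorderings pi) R) (P_prod : product_uniform P).

(** Borel-Cantelli along the squares, where the bounds [1 / (e^2 N)] become
    summable. *)
Lemma ae_deviation_squares (g : R -> R) e :
  (forall x, g x \in `[0, 1]) -> 0 < e ->
  {ae P, forall w, \forall m \near \oo,
     `|deviation g w (m.+1 ^ 2)| <= e * (m.+1 ^ 2)%:R}.
Proof.
move=> g01 e0.
pose F m := large_deviation (pi := pi) g e (m.+1 ^ 2).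
have N0 m : (0 < m.+1 ^ 2)%N by [].
have mF m : measurable (F m).
  by have [] := large_deviation_prob pi_part P_prod g01 e0 (N0 m).
exists (lim_sup_set F); split.
- by apply: bigcap_measurable => [|n _]; [exists 0%N | exact: bigcup_measurable].
- apply: lim_sup_set_cvg0 => //.
  apply: (@le_lt_trans _ _ (2 / e ^+ 2)%:E); last by rewrite ltry.
  apply: lime_le; first by apply: is_cvg_nneseries => m _ _; exact: measure_ge0.
  apply: nearW => n.
  apply: (@le_trans _ _ (\sum_(0 <= m < n) (((e ^+ 2 * (m.+1 ^ 2)%:R)^-1)%:E))%E).
    apply: lee_sum => m _.
    by have [] := large_deviation_prob pi_part P_prod g01 e0 (N0 m).
  rewrite sumEFin lee_fin big_mkord.
  under eq_bigr => m _ do rewrite invfM.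
  by rewrite -mulr_sumr mulrC ler_pM2r ?invr_gt0 ?exprn_gt0// sum_inv_sqr_le2.
- move=> w nw n _; apply: contrapT => h; apply: nw; exists n => // m nm /=.
  apply/ltW; rewrite ltNge; apply/negP => hm; apply: h; by exists m.
Qed.

Lemma ae_sublinear_deviation (g : R -> R) : (forall x, g x \in `[0, 1]) ->
  {ae P, forall w, sublinear (deviation g w)}.
Proof.
move=> g01.
have : {ae P, forall w, forall p, \forall m \near \oo,
     `|deviation g w (m.+1 ^ 2)| <= p.+1%:R^-1 * (m.+1 ^ 2)%:R}.
  by apply: ae_foralln => p; apply: ae_deviation_squares.
apply: filterS => w hw; apply: sublinear_squares => [n|e e0].
  by rewrite /deviation big_ord_recr/= addrAC subrr add0r norm_centered_le1.
have [p pe] : exists p, p.+1%:R^-1 <= e.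
  have [p _ hp] := (cvgrPdist_le _ _).1 (@cvg_harmonic R) e e0.
  by exists p; have := hp p (leqnn p); rewrite /= sub0r normrN ger0_norm.
by apply: filterS (hw p) => m /le_trans; apply; rewrite ler_wpM2r.
Qed.

End almost_sure.

(** * Continuous functions *)

Lemma sublinear_deviation_continuous (R : realType) (pi : nat -> seq R)
    (w : reorderings pi) (f : R -> R) :
  (forall n, itv_partition 0 1 (pi n)) ->
  (forall r i, sublinear (deviation (cell r i) w)) ->
  {within `[0, 1], continuous f} -> sublinear (deviation f w).
Proof.
move=> pi_part hw cf; apply: sublinear_approx => e e0.
have e20 : 0 < e / 2 by rewrite divr_gt0.
have [r hr] := step_approx cf e20.
exists (deviation (fun x => \sum_(i < r.+2) f (i%:R / r.+1%:R) * cell r i x) w).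
  rewrite (_ : deviation _ _ = fun N =>
    \sum_(i < r.+2) f (i%:R / r.+1%:R) * deviation (cell r i) w N).
    by apply: sublinear_comb => i; exact: hw.
  by apply/funext => N; rewrite deviation_comb.
by move=> N; rewrite (le_trans (deviation_dist _ _ _ hr))// [2 * _]mulrC divfK.
Qed.

Lemma mean_block_means_cvg (R : realType) (k : nat -> nat) (u : nat -> R) (l : R) :
  (forall n, (0 < k n)%N) -> u @ \oo --> l ->
  (fun N => N%:R^-1 * \sum_(m < N) u (block_index k m)) @ \oo --> l.
Proof.
move=> k0 ul; rewrite -cvg_shiftS /=.
have /cesaro : (u \o block_index k) @ \oo --> l.
  exact: cvg_comp (block_index_cvg k0) ul.
rewrite /arithmetic_mean /series /=.
by under eq_fun do rewrite big_mkord.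
Qed.

Theorem theorem3p4 (R : realType) (pi : nat -> seq R)
    (pi_ud : ud_partitions pi)
    (P : probability (reorderings pi) R) (P_prod : product_uniform P) :
  {ae P, forall w, ud_points (sequential_reordering w)}.
Proof.
have [pi_part pi_cvg] := pi_ud.
have : {ae P, forall w, forall r i, sublinear (deviation (cell r i) w)}.
  apply: ae_foralln => r; apply: ae_foralln => i.
  by apply: ae_sublinear_deviation => // x; exact: cell_in01.
apply: filterS => w hw; split=> [m|f cf]; first exact: sequential_reordering_in01.
have -> : (fun N => N%:R^-1 * \sum_(m < N) f (sequential_reordering w m)) =
    (fun N => N%:R^-1 * deviation f w N + N%:R^-1 *
      \sum_(m < N) block_mean pi f (block_index (fun n => size (pi n)) m)).
  by apply/funext => N; rewrite -mulrDr /deviation sumrB subrK.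
rewrite -[X in _ --> X]add0r; apply: cvgD.
  exact: sublinear_deviation_continuous.
exact: mean_block_means_cvg (size_partition_gt0 pi_part) (pi_cvg f cf).
Qed.
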